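(* Let $f$ be a function having a primitive on an interval $I\subseteq\mathbb{R}$ and let $n\ge 1$ be an integer. Then, on $I$, $$\int\cdots\int f(x)\,dx^n=\sum_{k=1}^{n}(-1)^{n-k}\frac{x^{k-1}}{(k-1)!}\left(\int\frac{x^{n-k}}{(n-k)!}f(x)\,dx\right)+C_n(x),\qquad C_n(x)=\sum_{i=0}^{n-1}c_i\frac{x^i}{i!},$$ where $c_0,\dots,c_{n-1}$ are arbitrary constants of integration. That is, for any fixed choice of primitives $\int\frac{x^{n-k}}{(n-k)!}f(x)\,dx$ ($1\le k\le n$) on $I$, the $n$-fold indefinite integrals of $f$ are exactly the functions given by the right-hand side as $c_0,\dots,c_{n-1}$ range over all constants.
   Context: The indefinite repeated integral of order $n$ of $f$, written $I_n=\int\cdots\int f(x)\,dx^n$ ($n$ integral signs), is defined recursively by $I_0=f(x)$ and $I_{n+1}=\int I_n\,dx$, each integration introducing an arbitrary constant; so it is the family of all functions obtained from $f$ by taking a primitive $n$ times in succession. A primitive (indefinite integral) of a function $g$ on $I$ is a function $G$ with $G'=g$ on $I$. Convention: $x^0=1$. *)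

(* Defs.v *)
From Stdlib Require Import Reals Factorial.
Open Scope R_scope.

(* Open, closed, half-open, bounded or unbounded. *)
Definition is_interval (I : R -> Prop) : Prop :=
  forall a b x : R, I a -> I b -> a <= x <= b -> I x.

(* [D_in] takes the difference quotient over points of [I] only, so the
   derivative is one-sided at an endpoint belonging to [I], and the values of
   [g] and [G] outside [I] play no role. *)
Definition is_primitive (I : R -> Prop) (g G : R -> R) : Prop :=
  forall x : R, I x -> D_in G g I x.

(* [repeated_integral I f n h]: [h] is, on [I], a member of the family of
   [n]-fold indefinite integrals of [f]. *)
Fixpoint repeated_integral (I : R -> Prop) (f : R -> R) (n : nat)
    (h : R -> R) : Prop :=
  match n with
  | O => forall x : R, I x -> h x = f x
  | S m => exists g : R -> R, repeated_integral I f m g /\ is_primitive I g h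
  end.

Definition weighted (f : R -> R) (j : nat) (x : R) : R :=
  x ^ j / INR (fact j) * f x.

(* Main.v *)
(* Put S_0 = f and S_(m+1) = sum_(i <= m) (-1)^(m-i) x^i/i! H_(m-i), where H_j is
   a primitive of x^j/j! f.  By the product rule the derivative of S_(m+1) is S_m:
   differentiating the monomials gives S_m (or 0 if m = 0), while differentiating
   the H_j gives f (x - x)^m / m! by the binomial theorem.  Since primitives on an
   interval are unique up to a constant, induction on the number of integrations
   gives the description of all repeated integrals.  The H_j exist because, for a
   primitive F of f, integration by parts reduces x^(j+1)/(j+1)! f to x^j/j! F,
   which is continuous. *)
Require Import Defs.
From Stdlib Require Import Reals Factorial Lra Lia Classical.
From Coquelicot Require Import Coquelicot.
Open Scope R_scope.

(** * Derivatives relative to a set, and projection onto a compact interval *)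

(** Serves to pass from [I] to the whole line at interior points, and from one function to another
    that agrees with it near [x0]. The values at [x0] are compared separately because [x0] need not
    lie in [D']. *)
Lemma D_in_local (D D' : R -> Prop) (G G' g g' : R -> R) (x0 delta : R) :
  0 < delta -> D_in G g D x0 -> G x0 = G' x0 -> g x0 = g' x0 ->
  (forall x, D' x -> Rabs (x - x0) < delta -> D x /\ G x = G' x) ->
  D_in G' g' D' x0.
Proof.
  intros Hd HG HG0 Hg0 Hloc eps Heps.
  destruct (HG eps Heps) as [alp [Halp H]].
  exists (Rmin alp delta); split.
  - now apply Rmin_pos.
  - intros x [[Dx Nx] Hx].
    destruct (Hloc x Dx) as [Dx' Ex].
    { eapply Rlt_le_trans; [exact Hx | apply Rmin_r]. }
    rewrite <- Ex, <- HG0, <- Hg0.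
    apply H; split; [now split |].
    eapply Rlt_le_trans; [exact Hx | apply Rmin_l].
Qed.

(** For [a <= b], composing with this projection extends a function continuous on [[a, b]] to one
    continuous on the whole line, as theorems with two-sided hypotheses require. *)
Definition clamp (a b t : R) : R := Rmax a (Rmin b t).

Lemma clamp_bounds (a b t : R) : a <= b -> a <= clamp a b t <= b.
Proof.
  intros Hab; unfold clamp; split; [apply Rmax_l |].
  apply Rmax_lub; [exact Hab | apply Rmin_l].
Qed.

Lemma clamp_id (a b t : R) : a <= t <= b -> clamp a b t = t.
Proof.
  intros H; unfold clamp; rewrite Rmin_right, Rmax_right; lra.
Qed.

Lemma clamp_contraction (a b s t : R) :
  Rabs (clamp a b t - clamp a b s) <= Rabs (t - s).
Proof.
  unfold clamp, Rmax, Rmin.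
  repeat destruct (Rle_dec _ _); unfold Rabs; repeat destruct (Rcase_abs _); lra.
Qed.

Lemma continuity_clamp (I : R -> Prop) (F : R -> R) (a b : R) :
  a <= b -> (forall x, a <= x <= b -> I x) ->
  (forall x, I x -> continue_in F I x) ->
  continuity (fun t => F (clamp a b t)).
Proof.
  intros Hab HI HF x eps Heps.
  pose proof (HI _ (clamp_bounds a b x Hab)) as Ix.
  destruct (HF _ Ix eps Heps) as [alp [Halp H]].
  exists alp; split; [exact Halp |].
  intros t [_ Ht]; simpl in *; unfold Rdist in *.
  (* The limit in [continue_in] excludes the base point, so coinciding projections are treated
     apart. *)
  destruct (Req_dec (clamp a b t) (clamp a b x)) as [E | E].
  - rewrite E, Rminus_diag, Rabs_R0; exact Heps.
  - apply H; split.
    + split; [apply HI, clamp_bounds, Hab | auto].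
    + eapply Rle_lt_trans; [apply clamp_contraction | exact Ht].
Qed.

(** * Primitives on an interval: rules, uniqueness, existence *)

Lemma is_primitive_continue (I : R -> Prop) (g G : R -> R) :
  is_primitive I g G -> forall x, I x -> continue_in G I x.
Proof. intros H x Ix; exact (cont_deriv _ _ _ _ (H x Ix)). Qed.

Lemma is_primitive_ext (I : R -> Prop) (g g' G G' : R -> R) :
  (forall x, I x -> g x = g' x) -> (forall x, I x -> G x = G' x) ->
  is_primitive I g G -> is_primitive I g' G'.
Proof.
  intros Eg EG H x Ix.
  apply (D_in_local I I G G' g g' x 1 Rlt_0_1 (H x Ix)); auto.
Qed.

Lemma is_primitive_plus (I : R -> Prop) (g1 g2 G1 G2 : R -> R) :
  is_primitive I g1 G1 -> is_primitive I g2 G2 ->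
  is_primitive I (fun x => g1 x + g2 x) (fun x => G1 x + G2 x).
Proof. intros H1 H2 x Ix; apply Dadd; auto. Qed.

Lemma is_primitive_minus (I : R -> Prop) (g1 g2 G1 G2 : R -> R) :
  is_primitive I g1 G1 -> is_primitive I g2 G2 ->
  is_primitive I (fun x => g1 x - g2 x) (fun x => G1 x - G2 x).
Proof. intros H1 H2 x Ix; apply Dminus; auto. Qed.

Lemma is_primitive_scal (I : R -> Prop) (c : R) (g G : R -> R) :
  is_primitive I g G -> is_primitive I (fun x => c * g x) (fun x => c * G x).
Proof. intros H x Ix; apply Dmult_const; auto. Qed.

Lemma is_primitive_mult (I : R -> Prop) (g1 g2 G1 G2 : R -> R) :
  is_primitive I g1 G1 -> is_primitive I g2 G2 ->
  is_primitive I (fun x => g1 x * G2 x + G1 x * g2 x) (fun x => G1 x * G2 x).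
Proof. intros H1 H2 x Ix; apply Dmult; auto. Qed.

Lemma is_primitive_sum (I : R -> Prop) (g G : nat -> R -> R) (n : nat) :
  (forall i, (i <= n)%nat -> is_primitive I (g i) (G i)) ->
  is_primitive I (fun x => sum_f_R0 (fun i => g i x) n)
    (fun x => sum_f_R0 (fun i => G i x) n).
Proof.
  induction n as [|n IH]; intros H; simpl.
  - now apply H.
  - apply is_primitive_plus; [apply IH; auto | now apply H].
Qed.

Lemma is_primitive_derive (I : R -> Prop) (g G : R -> R) :
  (forall x, is_derive G x (g x)) -> is_primitive I g G.
Proof.
  intros H x _.
  apply (D_in_imp _ _ no_cond); [intros; exact Logic.I |].
  apply derivable_pt_lim_D_in, is_derive_Reals, H.
Qed.

(* The mean value theorem asks for two-sided continuity at the endpoints [x] and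
   [y], so it is applied to [u] composed with the projection onto [[x, y]]. *)
Lemma zero_primitive_constant (I : R -> Prop) (u : R -> R) :
  is_interval I -> is_primitive I (fun _ => 0) u ->
  forall x y, I x -> I y -> u x = u y.
Proof.
  intros hI Hu.
  assert (Hlt : forall x y, I x -> I y -> x < y -> u x = u y).
  { intros x y Ix Iy Hxy.
    assert (HI : forall t, x <= t <= y -> I t) by (intros t Ht; now apply (hI x y)).
    destruct (MVT_gen (fun t => u (clamp x y t)) x y (fun _ => 0)) as [c [_ Hc]];
      try rewrite Rmin_left, Rmax_right by lra.
    - intros t Ht; apply is_derive_Reals.
      apply (derivable_pt_lim_D_in _ (fun _ => 0)).
      (* Within this radius of the interior point [t] the projection is the identity, so the
         derivative relative to [I] becomes a two-sided one. *)
      assert (Hd : 0 < Rmin (t - x) (y - t)) by (apply Rmin_pos; lra).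
      apply (D_in_local I _ u _ (fun _ => 0) _ t _ Hd (Hu t (HI t ltac:(lra)))).
      + now rewrite clamp_id by lra.
      + reflexivity.
      + intros s _ Hs.
        pose proof (Rmin_l (t - x) (y - t)); pose proof (Rmin_r (t - x) (y - t)).
        apply Rabs_def2 in Hs.
        rewrite clamp_id by lra; split; [apply HI; lra | reflexivity].
    - intros t _; apply (continuity_clamp I); [lra | exact HI |].
      now apply is_primitive_continue with (g := fun _ => 0).
    - rewrite !clamp_id in Hc by lra; lra. }
  intros x y Ix Iy; destruct (Rtotal_order x y) as [L | [E | L]].
  - now apply Hlt.
  - now rewrite E.
  - now symmetry; apply Hlt.
Qed.

Lemma is_primitive_unique (I : R -> Prop) (g G1 G2 : R -> R) :
  is_interval I -> is_primitive I g G1 -> is_primitive I g G2 ->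
  exists c, forall x, I x -> G1 x = G2 x + c.
Proof.
  intros hI H1 H2.
  destruct (classic (exists a, I a)) as [[a Ia] | Hempty].
  - exists (G1 a - G2 a); intros x Ix.
    enough (G1 x - G2 x = G1 a - G2 a) by lra.
    apply (zero_primitive_constant I (fun t => G1 t - G2 t) hI); auto.
    apply is_primitive_ext with (g := fun t => g t - g t)
      (G := fun t => G1 t - G2 t); auto.
    + intros; ring.
    + now apply is_primitive_minus.
  - exists 0; intros x Ix; exfalso; eauto.
Qed.

(* Some compact subinterval [[l, r]] of [I] contains [a] and a neighbourhood of
   [x] relative to [I]. *)
Lemma interval_compact_nbhd (I : R -> Prop) (a x : R) :
  is_interval I -> I a -> I x ->
  exists l r delta, l <= a <= r /\ l <= x <= r /\ I l /\ I r /\ 0 < delta /\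
    forall t, I t -> Rabs (t - x) < delta -> l <= t <= r.
Proof.
  intros hI Ia Ix.
  (* Either [I] has a point [y] beyond [x], and [r = max(a, y)], [d = y - x] work, or [x] is the
     maximum of [I], and [r = x] works with any positive [d]. *)
  assert (Hr : exists r d, a <= r /\ x <= r /\ I r /\ 0 < d /\
            forall t, I t -> t < x + d -> t <= r).
  { destruct (classic (exists y, I y /\ x < y)) as [[y [Iy Hy]] | N].
    - exists (Rmax a y), (y - x).
      pose proof (Rmax_l a y); pose proof (Rmax_r a y).
      repeat split; try lra.
      + unfold Rmax; destruct (Rle_dec a y); auto.
      + intros; lra.
    - assert (Hmax : forall t, I t -> t <= x).
      { intros t It; apply Rnot_lt_le; intros Hlt; apply N; eauto. }
      exists x, 1; repeat split; auto; lra. }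
  assert (Hl : exists l d, l <= a /\ l <= x /\ I l /\ 0 < d /\
            forall t, I t -> x - d < t -> l <= t).
  { destruct (classic (exists y, I y /\ y < x)) as [[y [Iy Hy]] | N].
    - exists (Rmin a y), (x - y).
      pose proof (Rmin_l a y); pose proof (Rmin_r a y).
      repeat split; try lra.
      + unfold Rmin; destruct (Rle_dec a y); auto.
      + intros; lra.
    - assert (Hmin : forall t, I t -> x <= t).
      { intros t It; apply Rnot_lt_le; intros Hlt; apply N; eauto. }
      exists x, 1; repeat split; auto; lra. }
  destruct Hr as [r [d [Har [Hxr [Ir [Hd Hr]]]]]].
  destruct Hl as [l [e [Hla [Hlx [Il [He Hl]]]]]].
  exists l, r, (Rmin d e); repeat split; auto.
  - now apply Rmin_pos.
  - apply Hl; auto.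
    pose proof (Rmin_r d e); apply Rabs_def2 in H0; lra.
  - apply Hr; auto.
    pose proof (Rmin_l d e); apply Rabs_def2 in H0; lra.
Qed.

(** The primitive is the integral from a base point [a]. Near [x] it equals the integral of [F]
    composed with the projection onto [[l, r]]; that integrand is continuous everywhere, so the
    fundamental theorem of calculus applies. *)
Lemma continuous_has_primitive (I : R -> Prop) (F : R -> R) :
  is_interval I -> (forall x, I x -> continue_in F I x) ->
  exists G, is_primitive I F G.
Proof.
  intros hI HF.
  destruct (classic (exists a, I a)) as [[a Ia] | Hempty].
  2: { exists F; intros x Ix; exfalso; eauto. }
  exists (fun x => RInt F a x); intros x Ix.
  destruct (interval_compact_nbhd I a x hI Ia Ix)
    as [l [r [d [Ha [Hx [Il [Ir [Hd Hloc]]]]]]]].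
  set (Fc := fun t => F (clamp l r t)).
  assert (Cc : forall t, continuous Fc t).
  { intros t; apply continuity_pt_filterlim.
    apply (continuity_clamp I F l r); [lra | | exact HF].
    intros s Hs; now apply (hI l r). }
  assert (E : forall t, l <= t <= r -> RInt Fc a t = RInt F a t).
  { intros t Ht; apply RInt_ext; intros s Hs; unfold Fc; rewrite clamp_id; auto.
    revert Hs; unfold Rmin, Rmax; destruct (Rle_dec a t); lra. }
  assert (Hprim : is_primitive I Fc (fun t => RInt Fc a t)).
  { apply is_primitive_derive; intros t.
    apply (is_derive_RInt Fc _ a t); [| apply Cc].
    apply filter_forall; intros s; apply (RInt_correct (V := R_CompleteNormedModule)).
    apply (ex_RInt_continuous (V := R_CompleteNormedModule)); auto. }
  apply (D_in_local I I (fun t => RInt Fc a t) _ Fc F x d Hd (Hprim x Ix)).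
  - now apply E.
  - unfold Fc; now rewrite clamp_id.
  - intros t It Ht; split; [exact It | apply E, Hloc; auto].
Qed.

(** * Divided powers and the weighted integrands *)

Definition monomial (i : nat) (x : R) : R := x ^ i / INR (fact i).

Lemma monomial_0 (x : R) : monomial 0 x = 1.
Proof. unfold monomial; simpl; field. Qed.

(** Zero stands apart because [pred 0] is [0], so [monomial (pred 0)] would give 1. *)
Definition monomial_derivative (i : nat) : R -> R :=
  match i with O => fun _ => 0 | S p => monomial p end.

Lemma is_primitive_monomial (I : R -> Prop) (i : nat) :
  is_primitive I (monomial_derivative i) (monomial i).
Proof.
  apply is_primitive_derive; intros x.
  destruct i as [|i]; unfold monomial_derivative, monomial; (auto_derive; [easy |]).
  - simpl; field.
  - change (fact i + i * fact i)%nat with (fact (S i)).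
    rewrite fact_simpl, mult_INR.
    change (match i with O => 1 | S _ => INR i + 1 end) with (INR (S i)).
    simpl pred; field; split; [apply INR_fact_neq_0 | now apply not_0_INR].
Qed.

(** Since [f] may be discontinuous, only [monomial i x * F x] is integrated, with result [K]; [F] is
    continuous because it is differentiable relative to [I]. *)
Lemma weighted_has_primitive (I : R -> Prop) (f : R -> R) (j : nat) :
  is_interval I -> (exists F, is_primitive I f F) ->
  exists G, is_primitive I (weighted f j) G.
Proof.
  intros hI [F HF]; destruct j as [|i].
  - exists F; apply is_primitive_ext with (g := f) (G := F); auto.
    intros x _; unfold weighted; simpl; field.
  - destruct (continuous_has_primitive I (fun x => monomial i x * F x) hI)
      as [K HK].
    { intros x Ix; apply limit_mul.
      - apply (is_primitive_continue I (monomial_derivative i)); auto.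
        apply is_primitive_monomial.
      - now apply (is_primitive_continue I f). }
    exists (fun x => monomial (S i) x * F x - K x).
    eapply is_primitive_ext with (G := fun x => monomial (S i) x * F x - K x);
      [| reflexivity |].
    2: { apply is_primitive_minus; [| exact HK].
         apply is_primitive_mult; [apply is_primitive_monomial | exact HF]. }
    intros x _; unfold weighted; fold (monomial (S i) x); simpl; ring.
Qed.

(** Binomial expansion of [(x + - x) ^ m] divided by [m!]; the case [m = 0] rests on [0 ^ 0 = 1]. *)
Lemma sum_monomial_alternating (m : nat) (x : R) :
  sum_f_R0 (fun i => (-1) ^ (m - i) * monomial i x * monomial (m - i) x) m =
  match m with O => 1 | S _ => 0 end.
Proof.
  transitivity ((x + - x) ^ m / INR (fact m)).
  - rewrite binomial; unfold Rdiv; rewrite Rmult_comm, scal_sum.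
    apply sum_eq; intros i Hi; unfold monomial, Binomial.C.
    replace (- x) with (-1 * x) by ring; rewrite Rpow_mult_distr.
    field; repeat split; apply INR_fact_neq_0.
  - rewrite Rplus_opp_r; destruct m; simpl; [field |].
    rewrite Rmult_0_l; unfold Rdiv; apply Rmult_0_l.
Qed.

(** * The particular repeated integral and the polynomial of constants *)

(** [H] is indexed by the exponent of the weight, so that one family serves for every [n] in the
    induction. *)
Definition particular_integral (f : R -> R) (H : nat -> R -> R) (n : nat)
    (x : R) : R :=
  match n with
  | O => f x
  | S m => sum_f_R0 (fun i => (-1) ^ (m - i) * (monomial i x * H (m - i)%nat x)) m
  end.

Lemma is_primitive_particular_integral (I : R -> Prop) (f : R -> R)
    (H : nat -> R -> R) (m : nat) :
  (forall j, (j <= m)%nat -> is_primitive I (weighted f j) (H j)) ->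
  is_primitive I (particular_integral f H m) (particular_integral f H (S m)).
Proof.
  intros HH.
  apply is_primitive_ext with
    (g := fun x => sum_f_R0 (fun i => (-1) ^ (m - i) *
            (monomial_derivative i x * H (m - i)%nat x + monomial i x * weighted f (m - i) x)) m)
    (G := particular_integral f H (S m)); auto.
  - intros x _.
    rewrite (sum_eq _ (fun i => (-1) ^ (m - i) * (monomial_derivative i x * H (m - i)%nat x) +
      ((-1) ^ (m - i) * monomial i x * monomial (m - i) x) * f x)).
    2: { intros i _; unfold weighted; fold (monomial (m - i) x); ring. }
    rewrite sum_plus, <- (scal_sum _ _ (f x)), sum_monomial_alternating.
    (* For [m = 0] only [f] is left. Otherwise the [f] part vanishes, the term [i = 0] is zero, and
       shifting [i] by one gives the previous sum. *)
    destruct m as [|p]; [simpl; ring |].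
    rewrite decomp_sum by lia; simpl; ring.
  - apply (is_primitive_sum I (fun i x => (-1) ^ (m - i) *
            (monomial_derivative i x * H (m - i)%nat x + monomial i x * weighted f (m - i) x))
            (fun i x => (-1) ^ (m - i) * (monomial i x * H (m - i)%nat x))).
    intros i Hi; apply is_primitive_scal, is_primitive_mult.
    + apply is_primitive_monomial.
    + apply HH; lia.
Qed.

Definition constants_poly (c : nat -> R) (n : nat) (x : R) : R :=
  match n with
  | O => 0
  | S m => sum_f_R0 (fun i => c i * monomial i x) m
  end.

(** Lets the additive constant of a new integration be absorbed into [c 0]. *)
Lemma constants_poly_change_0 (c c' : nat -> R) (m : nat) (x : R) :
  (forall i, c (S i) = c' (S i)) ->
  constants_poly c (S m) x = constants_poly c' (S m) x + (c O - c' O).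
Proof.
  intros E; unfold constants_poly; induction m as [|m IH].
  - simpl; rewrite monomial_0; ring.
  - rewrite !tech5, IH, E; ring.
Qed.

(** On divided powers differentiation is a pure shift of the coefficients. *)
Lemma is_primitive_constants_poly (I : R -> Prop) (c : nat -> R) (m : nat) :
  is_primitive I (constants_poly (fun i => c (S i)) m) (constants_poly c (S m)).
Proof.
  apply is_primitive_ext with
    (g := fun x => sum_f_R0 (fun i => c i * monomial_derivative i x) m)
    (G := constants_poly c (S m)); auto.
  - intros x _; destruct m as [|p]; [simpl; ring |].
    rewrite decomp_sum by lia; simpl; ring.
  - apply (is_primitive_sum I (fun i x => c i * monomial_derivative i x)
             (fun i x => c i * monomial i x)).
    intros i _; apply is_primitive_scal, is_primitive_monomial.
Qed.

(** * Description of all repeated integrals *)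

Lemma repeated_integral_iff (I : R -> Prop) (f : R -> R) (H : nat -> R -> R)
    (n : nat) :
  is_interval I ->
  (forall j, (j < n)%nat -> is_primitive I (weighted f j) (H j)) ->
  forall h, repeated_integral I f n h <->
    exists c, forall x, I x ->
      h x = particular_integral f H n x + constants_poly c n x.
Proof.
  intros hI; induction n as [|m IH]; intros HH h.
  - simpl; split.
    + intros Hh; exists (fun _ => 0); intros x Ix; rewrite Hh by assumption; ring.
    + intros [c Hc] x Ix; rewrite Hc by assumption; ring.
  - assert (Hprim : forall c, is_primitive I
        (fun x => particular_integral f H m x + constants_poly (fun i => c (S i)) m x)
        (fun x => particular_integral f H (S m) x + constants_poly c (S m) x)).
    { intros c; apply is_primitive_plus; [| apply is_primitive_constants_poly].
      apply is_primitive_particular_integral; intros j Hj; apply HH; lia. }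
    change (repeated_integral I f (S m) h)
      with (exists g, repeated_integral I f m g /\ is_primitive I g h).
    split.
    + intros [g [Hg Hh]].
      apply IH in Hg; [| intros j Hj; apply HH; lia].
      destruct Hg as [c Hc].
      (* Integration moves each old constant up one degree and inserts [a] as the new [c 0]; [a = 0]
         gives a reference primitive to compare with [h]. *)
      set (shift := fun a i => match i with O => a | S p => c p end).
      apply is_primitive_ext with (G' := h) (2 := fun x _ => eq_refl) (1 := Hc) in Hh.
      destruct (is_primitive_unique I _ _ _ hI Hh (Hprim (shift 0))) as [a Ha].
      exists (shift a); intros x Ix; rewrite (Ha x Ix).
      rewrite (constants_poly_change_0 (shift a) (shift 0)) by reflexivity.
      simpl; ring.
    + intros [c Hc].
      (* The witness is the derivative of the right-hand side: the constant [c 0] drops out. *)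
      exists (fun x => particular_integral f H m x
                       + constants_poly (fun i => c (S i)) m x).
      split.
      * apply IH; [intros j Hj; apply HH; lia |].
        exists (fun i => c (S i)); auto.
      * eapply is_primitive_ext; [| | apply (Hprim c)]; [reflexivity |].
        intros x Ix; now rewrite Hc.
Qed.

Theorem theorem2p1 (I : R -> Prop) (f : R -> R) (n : nat)
  (hI : is_interval I)
  (hf : exists F : R -> R, is_primitive I f F)
  (hn : (1 <= n)%nat) :
  (forall k : nat, (1 <= k <= n)%nat ->
     exists G : R -> R, is_primitive I (weighted f (n - k)) G) /\
  (forall G : nat -> R -> R,
     (forall k : nat, (1 <= k <= n)%nat ->
        is_primitive I (weighted f (n - k)) (G k)) ->
     forall h : R -> R,
       repeated_integral I f n h <->
       exists c : nat -> R, forall x : R, I x ->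
         h x =
           sum_f 1 n (fun k : nat =>
             (-1) ^ (n - k) * (x ^ (k - 1) / INR (fact (k - 1))) * G k x)
           + sum_f_R0 (fun i : nat => c i * (x ^ i / INR (fact i))) (n - 1)).
Proof.
  split.
  - intros k _; now apply weighted_has_primitive.
  - intros G HG h.
    (* [G] is indexed by [k] and [H] by the exponent [j = n - k]; for [j < n] the index [n - j] lies
       between 1 and [n]. *)
    rewrite (repeated_integral_iff I f (fun j => G (n - j)%nat) n hI).
    2: { intros j Hj; replace (weighted f j) with (weighted f (n - (n - j))).
         - apply HG; lia.
         - f_equal; lia. }
    destruct n as [|m]; [lia |].
    assert (E : forall x,
      particular_integral f (fun j => G (S m - j)%nat) (S m) x =
      sum_f 1 (S m) (fun k : nat =>
        (-1) ^ (S m - k) * (x ^ (k - 1) / INR (fact (k - 1))) * G k x)).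
    (* [sum_f 1] runs over [k = i + 1] with [i] from 0 to [m]. *)
    { intros x; unfold sum_f, particular_integral.
      replace (S m - 1)%nat with m by lia.
      apply sum_eq; intros i Hi.
      replace (S m - (i + 1))%nat with (m - i)%nat by lia.
      replace (S m - (m - i))%nat with (i + 1)%nat by lia.
      replace (i + 1 - 1)%nat with i by lia.
      unfold monomial; ring. }
    replace (S m - 1)%nat with m by lia.
    split; intros [c Hc]; exists c; intros x Ix; rewrite (Hc x Ix), E; reflexivity.
Qed.
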